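(* Let $X$ be a real Hilbert space, let $m$ be a positive integer, and let $R_1,\ldots,R_m$ be arbitrary maps from $X$ to $X$. Then for every integer $k$ with $1\le k\le m-1$, $$\operatorname{Fix}(R_mR_{m-1}\cdots R_2R_1)=(R_mR_{m-1}\cdots R_{k+1})\big(\operatorname{Fix}(R_kR_{k-1}\cdots R_1\,R_mR_{m-1}\cdots R_{k+1})\big).$$ That is, $$\operatorname{Fix}(R_m\cdots R_1)=(R_m\cdots R_2)\big(\operatorname{Fix}(R_1R_m\cdots R_2)\big)=(R_m\cdots R_3)\big(\operatorname{Fix}(R_2R_1R_m\cdots R_3)\big)=\cdots=R_m\big(\operatorname{Fix}(R_{m-1}\cdots R_1R_m)\big).$$
   Context: For a map $T\colon X\to X$, $\operatorname{Fix} T=\{x\in X : Tx=x\}$. Juxtaposition of maps denotes composition, and $T(S)=\{Tx : x\in S\}$ for $S\subseteq X$. No linearity, continuity or nonexpansiveness of the maps is assumed. *)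

(* Defs.v *)
From HB Require Import structures.
From mathcomp Require Import all_boot all_order all_algebra.
From mathcomp Require Import all_classical all_reals all_analysis.

Set Implicit Arguments.
Unset Strict Implicit.
Unset Printing Implicit Defensive.

Import Order.TTheory GRing.Theory Num.Theory.
Import numFieldNormedType.Exports.

Local Open Scope classical_set_scope.
Local Open Scope ring_scope.

(* A real Hilbert space is a complete normed space whose norm comes from an
   inner product, i.e., a positive definite symmetric bilinear form. *)
HB.mixin Record CompleteNormedModule_isHilbert (K : realType) X
    of CompleteNormedModule K X := {
  inner : {dot X for @idfun K} ;
  sqr_norm_inner : forall x : X, `|x| ^+ 2 = inner x x
}.

#[short(type="hilbertType")]
HB.structure Definition Hilbert (K : realType) :=
  {X of CompleteNormedModule K X & CompleteNormedModule_isHilbert K X}.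

Definition Fix (X : Type) (T : X -> X) : set X := [set x | T x = x].

(* The maps R_1, ..., R_m are numbered from 1, whereas the ordinals of 'I_m
   start at 0: i : 'I_m indexes the map R_(i+1). Then comp_range R a b is the
   composition R_b R_(b-1) ... R_a, in which R_a is applied first. *)
Definition comp_range (X : Type) (m : nat) (R : 'I_m -> X -> X) (a b : nat) :
    X -> X :=
  \big[(fun f g => f \o g)/idfun]_(i <- rev (enum 'I_m) | (a <= i.+1 <= b)%N) R i.

(* Main.v *)
Require Import Defs.
From mathcomp Require Import all_boot all_order all_algebra.
From mathcomp Require Import all_classical all_reals all_analysis.

(** Put [g = R_k ... R_1] and [f = R_m ... R_(k+1)], so that the full
    composition is [f \o g].  If [f (g x) = x], then [y = g x] satisfies
    [g (f y) = y] and [x = f y]; conversely, [g (f y) = y] gives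
    [f (g (f y)) = f y].  So [f] carries the fixed points of [g \o f] onto those
    of [f \o g] ([Fix_comp]), for arbitrary maps between arbitrary types.

    It remains to cut the composition of [R_1, ..., R_m] at [k]
    ([comp_range_cut]).  Composition does not commute, so the cut relies on the
    order of the indices: those above [k] form a prefix of the decreasing
    enumeration. *)

Local Open Scope classical_set_scope.

Lemma Fix_comp (X Y : Type) (f : Y -> X) (g : X -> Y) :
  Fix (f \o g) = f @` Fix (g \o f).
Proof.
apply/seteqP; split => [x fgx|_ [y gfy <-]]; last exact: (congr1 f gfy).
by exists (g x) => //; exact: (congr1 g fgx).
Qed.

(** Once an index outside [Q] has been met, no index in [Q] follows, so
    separating the two kinds of indices permutes no factors. *)
Lemma big_comp_split (I X : Type) (F : I -> X -> X) (P Q : pred I) (s : seq I) :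
  pairwise (fun i j => Q j ==> Q i) s ->
  \big[(fun f g => f \o g)/idfun]_(i <- s | P i) F i =
  \big[(fun f g => f \o g)/idfun]_(i <- s | P i && Q i) F i \o
  \big[(fun f g => f \o g)/idfun]_(i <- s | P i && ~~ Q i) F i.
Proof.
elim: s => [|x s IHs] /=; first by rewrite !big_nil.
case/andP => Qx /IHs {}IHs; rewrite !big_cons.
case: (boolP (Q x)) Qx => Qx sQ; first by rewrite andbT andbF IHs; case: (P x).
(* Once the head lies outside [Q], so does the whole tail: the left factor is
   an empty composition. *)
have noQ : ~~ has (fun i => P i && Q i) s.
  rewrite -all_predC; apply: sub_all sQ => i /=.
  by rewrite implybF negb_and => ->; rewrite orbT.
have empty : \big[(fun f g => f \o g)/idfun]_(i <- s | P i && Q i) F i = idfun.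
  by rewrite big_hasC.
by rewrite andbF andbT IHs empty; case: (P x).
Qed.

Lemma comp_range_cut (X : Type) (m : nat) (R : 'I_m -> X -> X) (a k b : nat) :
  (a <= k.+1)%N -> (k <= b)%N ->
  comp_range R a b = comp_range R k.+1 b \o comp_range R a k.
Proof.
move=> ak kb; rewrite /comp_range.
rewrite (@big_comp_split _ _ _ _ (fun i : 'I_m => k < i.+1)%N).
  congr (_ \o _); apply: eq_bigl => i.
    apply/andP/andP => [[/andP[_ ib] ki]|[ki ib]] //.
    by rewrite ib (leq_trans ak ki).
  rewrite -leqNgt; apply/andP/andP => [[/andP[ai _] ik]|[ai ik]] //.
  by rewrite ai (leq_trans ik kb).
have : pairwise (fun i j => j < i)%N (map val (rev (enum 'I_m))).
  rewrite -sorted_pairwise; last by move=> x y z /= xy zx; exact: ltn_trans xy.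
  by rewrite map_rev val_enum_ord rev_sorted; exact: iota_ltn_sorted.
rewrite pairwise_map; apply: sub_pairwise => i j /= ji.
by apply/implyP => kj; rewrite (leq_trans kj)// ltnS ltnW.
Qed.

Theorem lemma2p3 (K : realType) (X : hilbertType K) (m : nat)
    (R : 'I_m -> X -> X) :
  (0 < m)%N ->
  forall k : nat, (1 <= k <= m.-1)%N ->
    Fix (comp_range R 1 m) =
    comp_range R k.+1 m @` Fix (comp_range R 1 k \o comp_range R k.+1 m).
Proof.
move=> _ k /andP[_ km].
have km' : (k <= m)%N by rewrite (leq_trans km) ?leq_pred.
by rewrite -Fix_comp -comp_range_cut.
Qed.
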